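(* Algorithm 2 (described in the context), executed for all $i\in I$ and all $k\in K$, has complexity $O\left(|I|\times|K|\times|J|\log|J|\right)$; that is, it can be carried out with $O(|I|\,|K|\,|J|\log|J|)$ elementary operations (arithmetic operations, square roots and comparisons of real numbers, each counted at unit cost).
   Context: $I$, $J$, $K$ are finite nonempty sets (facilities, customers, tangent points), with $|J|\ge 2$ for the $O$-notation. For each $i\in I$, $k\in K$, $j\in J$ the real numbers $q_j^{i,k}$, $r_j^{i,k}\ge 0$ and $u_j^t$ are given. For each pair $(i,k)$, Algorithm 2 addresses the binary problem $$\min_{y\in\{0,1\}^J}\ \sum_{j\in J}\left(q_j^{i,k}-u_j^t\right)y_j+\sqrt{\sum_{j\in J}r_j^{i,k}y_j}.$$ Algorithm 2, for given $(i,k)$: Step 1. For each $j\in J$: if $q_j^{i,k}-u_j^t\ge 0$, put $j$ in $J_1$; if $q_j^{i,k}-u_j^t<0$ and $r_j^{i,k}=0$, put $j$ in $J_2$; otherwise put $j$ in $J_3$. Step 2. Set $y_{ij}=0$ for $j\in J_1$ and $y_{ij}=1$ for $j\in J_2$. Step 3. Sort the elements of $J_3$ in non-decreasing order of $\left(q_j^{i,k}-u_j^t\right)/r_j^{i,k}$. Step 4. For $m=1,\dots,|J_3|$ let $J_3^{(m)}$ be the set of the first $m$ elements of $J_3$ in this order, compute $$Q_m:=\sum_{j\in J_3^{(m)}}\left(q_j^{i,k}-u_j^t\right)+\sqrt{\sum_{j\in J_3^{(m)}}r_j^{i,k}},$$ and find $m^*\in\operatorname{argmin}_{m}Q_m$.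 Step 5. Set $y_{ij}=1$ for the first $m^*$ elements of $J_3$ and $y_{ij}=0$ for the remaining elements of $J_3$. *)

(* Defs.v *)
From mathcomp Require Import all_boot all_order all_algebra.
From mathcomp Require Import reals.

Set Implicit Arguments.
Unset Strict Implicit.
Unset Printing Implicit Defensive.

Import Order.TTheory GRing.Theory Num.Theory.
Local Open Scope ring_scope.

(* A real RAM: a finite program text, independent of the field [R] and of the
   instance, working on arrays of natural numbers (sizes, indices, flags) and
   arrays of real numbers, each addressed by an array name and an index.
   A scalar register is cell 0 of an array.  Index arithmetic is restricted to
   addition and truncated subtraction, and a real number can influence the
   integer memory or the control flow only through a comparison [RLe]. *)

Inductive iexp : Type :=
| ILit of nat
| IGet of nat & iexp
| IAdd of iexp & iexp
| ISub of iexp & iexp.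

Inductive rexp : Type :=
| RLit of nat
| RGet of nat & iexp
| RAdd of rexp & rexp
| RSub of rexp & rexp
| RMul of rexp & rexp
| RDiv of rexp & rexp
| RSqrt of rexp.

Inductive bexp : Type :=
| ILe of iexp & iexp
| RLe of rexp & rexp
| BNot of bexp
| BAnd of bexp & bexp.

Inductive cmd : Type :=
| Skip
| ISet of nat & iexp & iexp
| RSet of nat & iexp & rexp
| Seq of cmd & cmd
| If of bexp & cmd & cmd
| While of bexp & cmd.

Record state (R : Type) := State {
  imem : nat -> nat -> nat;
  rmem : nat -> nat -> R
}.

Definition upd (T : Type) (f : nat -> nat -> T) (a n : nat) (v : T)
    : nat -> nat -> T :=
  fun a' n' => if (a' == a) && (n' == n) then v else f a' n'.

Fixpoint ieval (R : Type) (s : state R) (e : iexp) : nat :=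
  match e with
  | ILit n => n
  | IGet a e1 => imem s a (ieval s e1)
  | IAdd e1 e2 => (ieval s e1 + ieval s e2)%N
  | ISub e1 e2 => (ieval s e1 - ieval s e2)%N
  end.

Fixpoint reval (R : realType) (s : state R) (e : rexp) : R :=
  match e with
  | RLit n => n%:R
  | RGet a e1 => rmem s a (ieval s e1)
  | RAdd e1 e2 => reval s e1 + reval s e2
  | RSub e1 e2 => reval s e1 - reval s e2
  | RMul e1 e2 => reval s e1 * reval s e2
  | RDiv e1 e2 => reval s e1 / reval s e2
  | RSqrt e1 => Num.sqrt (reval s e1)
  end.

Fixpoint beval (R : realType) (s : state R) (b : bexp) : bool :=
  match b with
  | ILe e1 e2 => (ieval s e1 <= ieval s e2)%N
  | RLe e1 e2 => reval s e1 <= reval s e2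
  | BNot b1 => ~~ beval s b1
  | BAnd b1 b2 => beval s b1 && beval s b2
  end.

(* Unit cost: every arithmetic operation, square root, comparison, Boolean
   connective, literal and memory access is charged one, on integers as well
   as on reals. *)
Fixpoint icost (e : iexp) : nat :=
  match e with
  | ILit _ => 1
  | IGet _ e1 => (icost e1).+1
  | IAdd e1 e2 | ISub e1 e2 => (icost e1 + icost e2).+1
  end.

Fixpoint rcost (e : rexp) : nat :=
  match e with
  | RLit _ => 1
  | RGet _ e1 => (icost e1).+1
  | RAdd e1 e2 | RSub e1 e2 | RMul e1 e2 | RDiv e1 e2 =>
      (rcost e1 + rcost e2).+1
  | RSqrt e1 => (rcost e1).+1
  end.

Fixpoint bcost (b : bexp) : nat :=
  match b with
  | ILe e1 e2 => (icost e1 + icost e2).+1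
  | RLe e1 e2 => (rcost e1 + rcost e2).+1
  | BNot b1 => (bcost b1).+1
  | BAnd b1 b2 => (bcost b1 + bcost b2).+1
  end.

(* [exec c s t s']: started in [s], the program [c] halts in [s'] after [t]
   elementary operations.  The relation is deterministic. *)
Inductive exec (R : realType) : cmd -> state R -> nat -> state R -> Prop :=
| exec_skip s :
    exec Skip s 0 s
| exec_iset a e1 e2 s :
    exec (ISet a e1 e2) s (icost e1 + icost e2).+1
      (State (upd (imem s) a (ieval s e1) (ieval s e2)) (rmem s))
| exec_rset a e1 e2 s :
    exec (RSet a e1 e2) s (icost e1 + rcost e2).+1
      (State (imem s) (upd (rmem s) a (ieval s e1) (reval s e2)))
| exec_seq c1 c2 s t1 s1 t2 s2 :
    exec c1 s t1 s1 -> exec c2 s1 t2 s2 ->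
    exec (Seq c1 c2) s (t1 + t2) s2
| exec_if_true b c1 c2 s t s' :
    beval s b = true -> exec c1 s t s' ->
    exec (If b c1 c2) s (bcost b + t) s'
| exec_if_false b c1 c2 s t s' :
    beval s b = false -> exec c2 s t s' ->
    exec (If b c1 c2) s (bcost b + t) s'
| exec_while_false b c s :
    beval s b = false ->
    exec (While b c) s (bcost b) s
| exec_while_true b c s t1 s1 t2 s2 :
    beval s b = true -> exec c s t1 s1 -> exec (While b c) s1 t2 s2 ->
    exec (While b c) s (bcost b + t1 + t2) s2.

(* One run of Algorithm 2, for a fixed pair (i,k): [c j] stands for
   q_j^{i,k} - u_j^t and [r j] for r_j^{i,k}. *)
Section Algorithm2.
Variables (R : realType) (J : finType) (c r : J -> R).

Definition J1 : {set J} := [set j | 0 <= c j].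
Definition J2 : {set J} := [set j | (c j < 0) && (r j == 0)].
Definition J3 : {set J} := ~: (J1 :|: J2).

Definition Q_of (s : seq J) (m : nat) : R :=
  \sum_(j <- take m s) c j + Num.sqrt (\sum_(j <- take m s) r j).

(* [s] is the order obtained in Step 3, [Q m] the value computed for m in
   Step 4, [mstar] the chosen minimizer and [y] the final assignment.  Ties in
   the sorting and in the argmin may be broken arbitrarily; for empty [J3],
   there is no m to range over and [mstar] is irrelevant. *)
Record algorithm2_run (s : seq J) (Q : nat -> R) (mstar : nat)
    (y : J -> bool) : Prop := {
  run_J1 : forall j, j \in J1 -> y j = false;
  run_J2 : forall j, j \in J2 -> y j = true;
  run_perm : perm_eq s (enum J3);
  run_sorted : sorted (fun j j' => c j / r j <= c j' / r j') s;
  run_Q : forall m, (1 <= m <= size s)%N -> Q m = Q_of s m;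
  run_mstar : (0 < size s)%N ->
    (1 <= mstar <= size s)%N /\
    (forall m, (1 <= m <= size s)%N -> Q mstar <= Q m);
  run_J3_first : forall j, j \in take mstar s -> y j = true;
  run_J3_rest : forall j, j \in drop mstar s -> y j = false
}.

End Algorithm2.

(* Row-major memory layout. *)
Definition rank (T : finType) (x : T) : nat := enum_rank x.

Definition addr2 (I K : finType) (i : I) (k : K) : nat :=
  (rank i * #|K| + rank k)%N.

Definition addr3 (I K J : finType) (i : I) (k : K) (j : J) : nat :=
  (addr2 i k * #|J| + rank j)%N.

(* Names of the integer arrays: the sizes |I|, |J|, |K| (input), the assignment
   y, |J3|, the order of J3, and mstar (output). *)
Definition aSize := 0%N.
Definition aY := 1%N.
Definition aLen := 2%N.
Definition aOrd := 3%N.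
Definition aMstar := 4%N.

(* Names of the real arrays: q, r, u (input) and the values Q_m (output). *)
Definition aq := 0%N.
Definition ar := 1%N.
Definition au := 2%N.
Definition aQ := 3%N.

(* The contents of all other cells are arbitrary. *)
Record input_loaded (R : realType) (I J K : finType)
    (q r : I -> K -> J -> R) (u : J -> R) (s : state R) : Prop := {
  in_I : imem s aSize 0 = #|I|;
  in_J : imem s aSize 1 = #|J|;
  in_K : imem s aSize 2 = #|K|;
  in_q : forall i k j, rmem s aq (addr3 i k j) = q i k j;
  in_r : forall i k j, rmem s ar (addr3 i k j) = r i k j;
  in_u : forall j, rmem s au (rank j) = u j
}.

(* The memory records, for the pair (i,k), all the data produced by a run of
   Algorithm 2: |J3|, the order of J3, the Q_m (the block of (i,k) starts with
   m = 1), mstar, and y. *)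
Definition algorithm2_recorded (R : realType) (I J K : finType)
    (q r : I -> K -> J -> R) (u : J -> R) (st : state R) (i : I) (k : K)
    : Prop :=
  exists (s : seq J) (y : J -> bool),
    [/\ algorithm2_run (fun j => q i k j - u j) (r i k) s
          (fun m => rmem st aQ (addr2 i k * #|J| + m.-1)%N)
          (imem st aMstar (addr2 i k)) y,
        imem st aLen (addr2 i k) = size s,
        map (fun l => imem st aOrd (addr2 i k * #|J| + l)%N) (iota 0 (size s)) =
          map (@rank J) s
      & forall j, imem st aY (addr3 i k j) = y j :> nat].

(* Main.v *)
Require Import Defs.
From mathcomp Require Import all_boot all_order all_algebra.
From mathcomp Require Import reals exp.
From mathcomp Require Import zify.

Set Implicit Arguments.
Unset Strict Implicit.
Unset Printing Implicit Defensive.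

Import Order.TTheory GRing.Theory Num.Theory.
Local Open Scope ring_scope.

(** Apart from the sorting in Step 3, everything Algorithm 2 does for a pair (i,k)
    is linear in |J|: classifying the customers is one scan, the values Q_m come
    from running sums of the two kinds of coefficients along the sorted order,
    so that each costs a constant number of operations, and their minimum is
    found in the same scan.  Sorting J3 costs O(|J| log |J|) by merge sort, and
    this dominates.  Summing over the pairs gives the bound.

    The machine has no procedure calls, so the sort is bottom-up: in each round
    the blocks of length w, already sorted, are merged two by two, and w doubles.
    A round is written as a single loop that emits one element per iteration,
    reloading the bounds of the two blocks when they are exhausted; its cost is
    then linear without further argument.  Its correctness rests on the invariant
    [merging], an equation between the expected result and the elements already
    written followed by the merge of what remains.  On sequences, [perm_pass] and
    [pass_sorted] show that a round permutes its input and doubles the sortedness,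
    so that [up_log 2 |J|] rounds suffice ([runs_merge_sort]).

    Programs are treated with triples [runs c s T Q]: from [s] the command [c]
    halts within [T] operations in a state satisfying [Q].  The phases are
    combined in [runs_solve_pair] and [runs_algorithm2]; [solved_run] turns their
    description by addresses into the data required of a run of Algorithm 2, and
    [total_cost_le] with [up_log_ln] turn the exact operation count into a
    multiple of |I| |K| |J| ln |J|. *)

(** * A cost-aware program logic for the real RAM *)

(** [iwrites] and [rwrites] collect the names of the arrays a command may assign;
    memory outside them is preserved by every execution ([exec_frame]), which
    frees the loop invariants below from listing what a loop leaves alone. *)
Fixpoint iwrites (c : cmd) : seq nat :=
  match c with
  | ISet a _ _ => [:: a]
  | Seq c1 c2 | If _ c1 c2 => iwrites c1 ++ iwrites c2
  | While _ c1 => iwrites c1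
  | _ => [::]
  end.

Fixpoint rwrites (c : cmd) : seq nat :=
  match c with
  | RSet a _ _ => [:: a]
  | Seq c1 c2 | If _ c1 c2 => rwrites c1 ++ rwrites c2
  | While _ c1 => rwrites c1
  | _ => [::]
  end.

Fixpoint straight (c : cmd) : bool :=
  match c with
  | Seq c1 c2 | If _ c1 c2 => straight c1 && straight c2
  | While _ _ => false
  | _ => true
  end.

Fixpoint wcost (c : cmd) : nat :=
  match c with
  | Skip | While _ _ => 0%N
  | ISet _ e1 e2 => (icost e1 + icost e2).+1
  | RSet _ e1 e2 => (icost e1 + rcost e2).+1
  | Seq c1 c2 => (wcost c1 + wcost c2)%N
  | If b c1 c2 => (bcost b + maxn (wcost c1) (wcost c2))%N
  end.

Section Logic.
Variable R : realType.
Implicit Types (s : state R) (c : cmd).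

Definition frame (W V : seq nat) s s' : Prop :=
  (forall a, a \notin W -> imem s' a =1 imem s a) /\
  (forall a, a \notin V -> rmem s' a =1 rmem s a).

(** A total-correctness triple with a time bound.  The post-condition is a plain
    predicate, so it can itself be a [runs] statement: this is what makes the
    sequencing rule [runs_seq] a simple continuation passing. *)
Definition runs c s (T : nat) (Q : state R -> Prop) : Prop :=
  exists t s', [/\ exec c s t s', (t <= T)%N & Q s'].

(** The cell 0 of the array [x] serves as the scalar register [x]. *)
Definition seti s x v : state R := State (upd (imem s) x 0 v) (rmem s).

Fixpoint run c s : state R :=
  match c with
  | ISet a e1 e2 =>
      State (upd (imem s) a (ieval s e1) (ieval s e2)) (rmem s)
  | RSet a e1 e2 =>
      State (imem s) (upd (rmem s) a (ieval s e1) (reval s e2))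
  | Seq c1 c2 => run c2 (run c1 s)
  | If b c1 c2 => if beval s b then run c1 s else run c2 s
  | Skip | While _ _ => s
  end.

Lemma frame_trans W V s1 s2 s3 :
  frame W V s1 s2 -> frame W V s2 s3 -> frame W V s1 s3.
Proof.
move=> [A1 B1] [A2 B2]; split=> a na n; first by rewrite A2 ?A1.
by rewrite B2 ?B1.
Qed.

Lemma frame_sub W V W' V' s s' :
  {subset W <= W'} -> {subset V <= V'} -> frame W V s s' -> frame W' V' s s'.
Proof.
move=> sW sV [A B]; split=> a na.
  by apply: A; apply: contra na => /sW.
by apply: B; apply: contra na => /sV.
Qed.

Lemma exec_frame c s t s' :
  exec c s t s' -> frame (iwrites c) (rwrites c) s s'.
Proof.
elim=> {c s t s'} //=.
- move=> a e1 e2 s; split=> // a' na n.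
  by rewrite /= /upd; move: na; rewrite inE => /negPf ->.
- move=> a e1 e2 s; split=> // a' na n.
  by rewrite /= /upd; move: na; rewrite inE => /negPf ->.
- move=> c1 c2 s t1 s1 t2 s2 _ F1 _ F2; apply: (@frame_trans _ _ _ s1).
    by apply: frame_sub F1 => x; rewrite mem_cat => ->.
  by apply: frame_sub F2 => x; rewrite mem_cat => ->; rewrite orbT.
- by move=> b c1 c2 s t s' _ _; apply: frame_sub => x; rewrite mem_cat => ->.
- by move=> b c1 c2 s t s' _ _; apply: frame_sub => x;
    rewrite mem_cat => ->; rewrite orbT.
- by move=> b c s t1 s1 t2 s2 _ _ F1 _ F2; apply: frame_trans F1 F2.
Qed.

Lemma runs_frame c s T Q :
  runs c s T Q ->
  runs c s T (fun s' => frame (iwrites c) (rwrites c) s s' /\ Q s').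
Proof.
move=> [t [s' [E le q]]]; exists t, s'; split=> //; split=> //.
exact: exec_frame E.
Qed.

Lemma runs_imp c s T (Q Q' : state R -> Prop) :
  (forall s', Q s' -> Q' s') -> runs c s T Q -> runs c s T Q'.
Proof. by move=> QQ [t [s' [E le /QQ q]]]; exists t, s'. Qed.

Lemma runs_le c s T T' Q : (T <= T')%N -> runs c s T Q -> runs c s T' Q.
Proof.
by move=> le [t [s' [E l q]]]; exists t, s'; split=> //; apply: leq_trans le.
Qed.

Lemma runs_seq c1 c2 s T1 T2 Q :
  runs c1 s T1 (fun s1 => runs c2 s1 T2 Q) -> runs (Seq c1 c2) s (T1 + T2) Q.
Proof.
move=> [t1 [s1 [E1 l1 [t2 [s2 [E2 l2 q]]]]]].
by exists (t1 + t2)%N, s2; split=> //; [apply: exec_seq E1 E2|apply: leq_add].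
Qed.

(** Code without loops is executed symbolically by [run]; [wcost] is its cost
    along the more expensive branch of every conditional. *)
Lemma runs_straight c s (Q : state R -> Prop) :
  straight c -> Q (run c s) -> runs c s (wcost c) Q.
Proof.
elim: c s Q => //=.
- by move=> s Q _ q; exists 0, s; split=> //; constructor.
- move=> a e1 e2 s Q _ q; do 2 eexists; split; first exact: exec_iset.
    exact: leqnn.
  exact: q.
- move=> a e1 e2 s Q _ q; do 2 eexists; split; first exact: exec_rset.
    exact: leqnn.
  exact: q.
- move=> c1 IH1 c2 IH2 s Q /andP[st1 st2] q.
  by apply/runs_seq/IH1 => //; apply: IH2.
- move=> b c1 IH1 c2 IH2 s Q /andP[st1 st2].
  case E: (beval s b) => q.
    have [t [s' [X l q']]] := IH1 _ _ st1 q.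
    exists (bcost b + t)%N, s'; split=> //; first exact: exec_if_true.
    by rewrite leq_add2l leq_max l.
  have [t [s' [X l q']]] := IH2 _ _ st2 q.
  exists (bcost b + t)%N, s'; split=> //; first exact: exec_if_false.
  by rewrite leq_add2l leq_max l orbT.
Qed.

(** The first argument of [Inv] is a variant: it bounds the number of remaining
    iterations, and hence both termination and the cost follow from it. *)
Lemma runs_while b c s T (Inv : nat -> state R -> Prop) k Q :
  Inv k s ->
  (forall k1 s1, frame (iwrites c) (rwrites c) s s1 -> Inv k1 s1 ->
     beval s1 b -> exists2 k2, k1 = k2.+1 & runs c s1 T (Inv k2)) ->
  (forall k1 s1, frame (iwrites c) (rwrites c) s s1 -> Inv k1 s1 ->
     ~~ beval s1 b -> Q s1) ->
  runs (While b c) s (k * (bcost b + T) + bcost b) Q.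
Proof.
move=> I0 step fin.
suff H k1 s1 : frame (iwrites c) (rwrites c) s s1 -> Inv k1 s1 ->
    runs (While b c) s1 (k1 * (bcost b + T) + bcost b) Q by apply: H.
elim: k1 s1 => [|k1 IH] s1 fr I1.
- case E: (beval s1 b); first by have [] := step _ _ fr I1 E.
  exists (bcost b), s1; split=> //; first exact: exec_while_false.
  by apply: (fin _ _ fr I1); rewrite E.
- case E: (beval s1 b); last first.
    exists (bcost b), s1; split; [exact: exec_while_false|lia|].
    by apply: (fin _ _ fr I1); rewrite E.
  have [k2 [<-] [t1 [s2 [E1 l1 I2]]]] := step _ _ fr I1 E.
  have [t2 [s3 [E2 l2 q]]] := IH s2 (frame_trans fr (exec_frame E1)) I2.
  exists (bcost b + t1 + t2)%N, s3; split=> //; first exact: exec_while_true E1 E2.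
  rewrite mulSn; lia.
Qed.
End Logic.

Definition sc (x : nat) : iexp := IGet x (ILit 0).
Definition iset (x : nat) (e : iexp) : cmd := ISet x (ILit 0) e.
Definition ILt (e1 e2 : iexp) : bexp := BNot (ILe e2 e1).

Definition For (x v z : nat) (c : cmd) : cmd :=
  Seq (iset x (ILit 0))
    (While (ILt (sc x) (IGet v (ILit z)))
       (Seq c (iset x (IAdd (sc x) (ILit 1))))).

(** One iteration pays 6 for the guard and 6 for the increment of the counter;
    the initialisation (3) and the last, failing guard (6) are paid once. *)
Definition for_cost (N T : nat) : nat := (N * (T + 12) + 9)%N.

(** The increment of the counter belongs to the loop and not to the body, so the
    invariant is re-established in the state where [x] already holds [l.+1]. *)
Lemma runs_for (R : realType) x v z c (s : state R) T
    (Inv : nat -> state R -> Prop) Q :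
  x != v -> x \notin iwrites c -> v \notin iwrites c ->
  Inv 0%N (seti s x 0) ->
  (forall l s1, frame (x :: iwrites c) (rwrites c) s s1 ->
     (l < imem s v z)%N -> imem s1 x 0 = l -> Inv l s1 ->
     runs c s1 T (fun s2 => Inv l.+1 (seti s2 x l.+1))) ->
  (forall s1, frame (x :: iwrites c) (rwrites c) s s1 ->
     Inv (imem s v z) s1 -> Q s1) ->
  runs (For x v z c) s (for_cost (imem s v z) T) Q.
Proof.
move=> nxv nx nv I0 step fin; set N := imem s v z.
pose c' := Seq c (iset x (IAdd (sc x) (ILit 1))).
have fr0 : frame (x :: iwrites c) (rwrites c) s (seti s x 0).
  by split=> // a; rewrite inE negb_or => /andP[/negPf na _] n; rewrite /= /upd na.
have frN s1 : frame (x :: iwrites c) (rwrites c) s s1 -> imem s1 v z = N.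
  by case=> H _; rewrite H // inE negb_or eq_sym nxv nv.
have frc s1 : frame (iwrites c') (rwrites c') (seti s x 0) s1 ->
    frame (x :: iwrites c) (rwrites c) s s1.
  move=> F; apply: frame_trans fr0 _; apply: frame_sub F => a.
    by rewrite /= mem_cat !inE orbC.
  by rewrite /= cats0.
apply: (@runs_le _ _ _ (wcost (iset x (ILit 0)) +
          (N * (6 + (T + 6)) + 6))); first by rewrite /for_cost /=; lia.
apply/runs_seq/runs_straight => //.
have -> : run (iset x (ILit 0)) s = seti s x 0 by [].
apply: (@runs_while _ _ c' _ (T + 6)
          (fun k s1 => [/\ imem s1 x 0 <= N, k = N - imem s1 x 0
                         & Inv (imem s1 x 0) s1])%N) => [|k s1 /frc F|k s1 /frc F].
- by rewrite /= /upd !eqxx subn0.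
- case=> le -> I1; rewrite /= (frN _ F) -ltnNge => lt.
  exists (N - (imem s1 x 0).+1)%N; first lia.
  apply: runs_seq; move: (step _ s1 F lt erefl I1) => /runs_frame.
  apply: runs_imp => s2 [[F2 _] I2]; apply: runs_straight => //=.
  by rewrite /upd /= !eqxx F2 //= addn1; split.
- case=> le _ I1; rewrite /= (frN _ F) -ltnNge -leqNgt => ge.
  have e : imem s1 x 0 = N by apply/eqP; rewrite eqn_leq le.
  by apply: fin F _; rewrite e in I1.
Qed.

(** * Bottom-up merging on sequences *)

Section Slice.
Local Open Scope nat_scope.
Variable T : Type.
Implicit Type f : nat -> T.

Definition slice f (lo hi : nat) : seq T := [seq f x | x <- iota lo (hi - lo)].

Lemma size_slice f lo hi : size (slice f lo hi) = hi - lo.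
Proof. by rewrite size_map size_iota. Qed.

Lemma slice_nil f lo hi : hi <= lo -> slice f lo hi = [::].
Proof. by rewrite /slice -subn_eq0 => /eqP ->. Qed.

Lemma slice_cons f lo hi : lo < hi -> slice f lo hi = f lo :: slice f lo.+1 hi.
Proof. by move=> lt; rewrite /slice subnS -(prednK (n := hi - lo)) ?subn_gt0. Qed.

Lemma slice_rcons f n : slice f 0 n.+1 = rcons (slice f 0 n) (f n).
Proof. by rewrite /slice !subn0 -addn1 iotaD map_cat cats1. Qed.

Lemma take_slice f lo hi w : take w (slice f lo hi) = slice f lo (minn (lo + w) hi).
Proof. by rewrite /slice -map_take take_iota; congr (map _ (iota _ _)); lia. Qed.

Lemma drop_slice f lo hi w : drop w (slice f lo hi) = slice f (lo + w) hi.
Proof. by rewrite /slice -map_drop drop_iota; congr (map _ (iota _ _)); lia. Qed.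

Lemma eq_slice f g lo hi :
  (forall x, lo <= x < hi -> f x = g x) -> slice f lo hi = slice g lo hi.
Proof.
move=> fg; case: (leqP hi lo) => [le|lt]; first by rewrite !slice_nil.
apply/eq_in_map => x; rewrite mem_iota => /andP[a b]; apply: fg; lia.
Qed.

End Slice.

Section MergePass.
Local Open Scope nat_scope.
Variables (T : eqType) (leT : rel T).
Hypothesis leT_total : total leT.
Implicit Types (L : seq T) (n w : nat).

(** One round of bottom-up merge sort: the consecutive blocks of length [w] are
    merged two by two.  The number [n] is fuel; any [n >= size L] is enough when
    [0 < w]. *)
Fixpoint pass n w L : seq T :=
  if n is n'.+1 then
    merge leT (take w L) (take w (drop w L)) ++ pass n' w (drop (w + w) L)
  else [::].

Definition blockwise_sorted w L : Prop :=
  forall k, sorted leT (take w (drop (k * w) L)).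

Lemma pass_nil n w : pass n w [::] = [::].
Proof. by elim: n => //= n ->. Qed.

Lemma perm_pass n w L : 0 < w -> size L <= n -> perm_eq (pass n w L) L.
Proof.
move=> w0; elim: n L => [|n IH] L /=; first by rewrite leqn0 => /nilP ->.
move=> le; rewrite -[X in perm_eq _ X](cat_take_drop w L).
rewrite -[X in perm_eq _ (_ ++ X)](cat_take_drop w (drop w L)).
rewrite catA; apply: perm_cat; first by rewrite perm_merge.
rewrite drop_drop; case: L le => [|x L] le; first by rewrite pass_nil.
by apply: IH; rewrite size_drop /= in le *; lia.
Qed.

(** A doubled block of the result is the merge of two blocks of [L], and dropping
    whole doubled blocks commutes with [pass]; induction on the fuel then peels
    off one doubled block at a time. *)
Lemma pass_sorted n w L :
  0 < w -> size L <= n -> blockwise_sorted w L -> blockwise_sorted (w + w) (pass n w L).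
Proof.
move=> w0; elim: n L => [|n IH] L le srt k //=.
have szM : size (merge leT (take w L) (take w (drop w L))) = minn (w + w) (size L).
  by rewrite size_merge size_cat !size_take_min size_drop; lia.
case: (leqP (w + w) (size L)) => [ge|lt].
  case: k => [|k].
    rewrite mul0n drop0 take_size_cat; last by rewrite szM; lia.
    apply: merge_sorted => //; first by have := srt 0; rewrite mul0n drop0.
    by have := srt 1; rewrite mul1n.
  (* Beyond the first doubled block, only the rest of the pass is seen. *)
  rewrite mulSnr -drop_drop drop_size_cat ?szM; last lia.
  apply: IH => [|j]; first by rewrite size_drop; lia.
  by rewrite drop_drop; have := srt (j + 2); rewrite mulnDl mul2n -addnn.
(* At most one doubled block is left, and it is the whole result. *)
rewrite [drop (w + w) L]drop_oversize ?pass_nil ?cats0; last lia.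
case: k => [|k]; last by rewrite drop_oversize // szM mulSn; lia.
rewrite mul0n drop0 take_oversize ?szM; last lia.
apply: merge_sorted => //; first by have := srt 0; rewrite mul0n drop0.
by have := srt 1; rewrite mul1n.
Qed.

Lemma blockwise_sorted1 L : blockwise_sorted 1 L.
Proof. by move=> k; case: (drop _ L) => //= x s; rewrite take0. Qed.

Lemma sorted_of_blockwise w L : size L <= w -> blockwise_sorted w L -> sorted leT L.
Proof. by move=> le /(_ 0); rewrite mul0n drop0 take_oversize. Qed.

Lemma merge_consl x s1 s2 :
  (forall y, ohead s2 = Some y -> leT x y) ->
  merge leT (x :: s1) s2 = x :: merge leT s1 s2.
Proof.
case: s2 => [|y s2] h /=; first by case: s1.
by rewrite h.
Qed.

Lemma merge_consr y s1 s2 :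
  (forall x, ohead s1 = Some x -> ~~ leT x y) ->
  merge leT s1 (y :: s2) = y :: merge leT s1 s2.
Proof.
case: s1 => [|x s1] h //=.
by rewrite ifN // h.
Qed.

(** Invariant of the single loop that carries out a whole round, writing one
    element of [B] per iteration: the remainders [i, mid) and [j, hi) of the two
    current blocks of [A] are still to be merged, and everything beyond [hi] is
    still to be treated.  The equation [merging_target] says that what is
    written, followed by the outcome of what remains, never changes.  Because
    each iteration emits exactly one element, the cost of a round needs no
    amortisation over blocks of unequal lengths. *)
Record merging (A : nat -> T) (w m : nat) (target : seq T) (B : nat -> T)
    (t i mid j hi : nat) : Prop := Merging {
  merging_i : i <= mid;
  merging_mid : mid <= j;
  merging_j : j <= hi;
  merging_hi : hi <= m;
  merging_t : t + mid = i + j;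
  merging_target : exists2 f, m <= hi + f &
    slice B 0 t ++ merge leT (slice A i mid) (slice A j hi)
      ++ pass f w (slice A hi m) = target
}.

Lemma merging_init A w m B :
  merging A w m (pass m w (slice A 0 m)) B 0 0 0 0 0.
Proof. by split=> //; exists m. Qed.

Lemma merging_end A w m target B i mid j hi :
  merging A w m target B m i mid j hi -> slice B 0 m = target.
Proof.
case=> h1 h2 h3 h4 h5 [f _ <-].
by rewrite !(slice_nil A) ?pass_nil ?cats0 //; lia.
Qed.

(** When both current blocks are exhausted, [merging_t] forces [t = hi] and the
    next two blocks are loaded; the minima truncate them at the end of the
    array. *)
Lemma merging_reload A w m target B t i mid j hi : 0 < w -> t < m -> hi <= t ->
  merging A w m target B t i mid j hi ->
  merging A w m target B t hi (minn (hi + w) m) (minn (hi + w) m)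
    (minn (minn (hi + w) m + w) m).
Proof.
move=> w0 tm ht [h1 h2 h3 h4 h5 [[|f] hf <-]]; first lia.
split; try lia.
exists f; first lia.
rewrite [slice A i mid]slice_nil ?[slice A j hi]slice_nil /=; try lia.
rewrite !drop_slice !take_slice.
congr (_ ++ (merge _ _ _ ++ pass _ _ _)).
  case: (leqP (hi + w) m) => [//|lt].
  by rewrite !slice_nil //; lia.
case: (leqP (hi + w + w) m) => [le|lt]; first by congr slice; lia.
by rewrite !slice_nil //; lia.
Qed.

Lemma merging_left A w m target B t i mid j hi :
  i < mid -> (j < hi -> leT (A i) (A j)) ->
  merging A w m target B t i mid j hi ->
  merging A w m target (fun x => if x == t then A i else B x) t.+1 i.+1 mid j hi.
Proof.
move=> im le [h1 h2 h3 h4 h5 [f hf <-]]; split=> //; first lia.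
exists f => //.
rewrite slice_rcons eqxx cat_rcons.
rewrite [slice A i mid]slice_cons // merge_consl.
  by congr (_ ++ _); apply: eq_slice => x xt; rewrite ifN //; lia.
move=> y; case: (ltnP j hi) => [lt|ge]; last by rewrite [slice A j hi]slice_nil.
by rewrite [slice A j hi]slice_cons // => -[<-]; apply: le.
Qed.

Lemma merging_right A w m target B t i mid j hi :
  t < hi -> (i < mid -> j < hi /\ ~~ leT (A i) (A j)) ->
  merging A w m target B t i mid j hi ->
  merging A w m target (fun x => if x == t then A j else B x) t.+1 i mid j.+1 hi.
Proof.
move=> thi le [h1 h2 h3 h4 h5 [f hf <-]].
have jh : j < hi by case: (ltnP i mid) => [/le[]|] //; lia.
split=> //; [lia|lia|].
exists f => //.
rewrite slice_rcons eqxx cat_rcons.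
rewrite [slice A j hi]slice_cons // merge_consr.
  by congr (_ ++ _); apply: eq_slice => x xt; rewrite ifN //; lia.
move=> y; case: (ltnP i mid) => [lt|ge]; last by rewrite [slice A i mid]slice_nil.
by rewrite [slice A i mid]slice_cons // => -[<-]; case: (le lt).
Qed.

End MergePass.

(** * The program and its phases *)

(** Scalar registers: number of pairs, current pair, first address of its block,
    loop counter, size of J3, block length of the sort, output position of a
    round, bounds of the two blocks being merged, current minimizer. *)
Definition vN := 5%N.
Definition vP := 6%N.
Definition vB := 7%N.
Definition vL := 8%N.
Definition vM := 9%N.
Definition vW := 10%N.
Definition vT := 11%N.
Definition vI := 12%N.
Definition vMid := 13%N.
Definition vJ := 14%N.
Definition vHi := 15%N.
Definition vBest := 16%N.
(** Integer work arrays: order of J3, its copy used by the sort, assignment. *)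
Definition tA := 17%N.
Definition tB := 18%N.
Definition tY := 19%N.

(** Real work arrays and registers: linear coefficients, sorting keys, running
    sums of both kinds of coefficients, values Q_m. *)
Definition tC := 4%N.
Definition tKey := 5%N.
Definition vSc := 6%N.
Definition vSr := 7%N.
Definition tQ := 8%N.

Definition incr (x : nat) : cmd := iset x (IAdd (sc x) (ILit 1)).
(** This is the minimum by [minnE], subtraction being truncated. *)
Definition IMin (e1 e2 : iexp) : iexp := ISub e1 (ISub e1 e2).
Definition here : iexp := IAdd (sc vB) (sc vL).

Definition classify_body : cmd :=
  Seq (RSet tC (sc vL) (RSub (RGet aq here) (RGet au (sc vL))))
 (Seq (RSet tKey (sc vL) (RDiv (RGet tC (sc vL)) (RGet ar here)))
  (If (RLe (RLit 0) (RGet tC (sc vL)))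
     (ISet tY (sc vL) (ILit 0))
  (If (RLe (RGet ar here) (RLit 0))
     (ISet tY (sc vL) (ILit 1))
     (Seq (ISet tY (sc vL) (ILit 0))
     (Seq (ISet tA (sc vM) (sc vL)) (incr vM)))))).

Definition classify : cmd :=
  Seq (iset vM (ILit 0)) (For vL aSize 1 classify_body).

(** The two commands below perform one iteration of a round; see [merging]. *)
Definition merge_reload : cmd :=
  If (ILe (sc vHi) (sc vT))
    (Seq (iset vI (sc vHi))
    (Seq (iset vMid (IMin (IAdd (sc vI) (sc vW)) (sc vM)))
    (Seq (iset vJ (sc vMid))
         (iset vHi (IMin (IAdd (sc vMid) (sc vW)) (sc vM))))))
    Skip.

Definition merge_pick : cmd :=
  If (BAnd (ILt (sc vI) (sc vMid))
           (BNot (BAnd (ILt (sc vJ) (sc vHi))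
                       (BNot (RLe (RGet tKey (IGet tA (sc vI)))
                                  (RGet tKey (IGet tA (sc vJ))))))))
    (Seq (ISet tB (sc vT) (IGet tA (sc vI))) (incr vI))
    (Seq (ISet tB (sc vT) (IGet tA (sc vJ))) (incr vJ)).

Definition merge_body : cmd := Seq merge_reload merge_pick.

Definition merge_pass : cmd :=
  Seq (Seq (iset vI (ILit 0)) (Seq (iset vMid (ILit 0))
      (Seq (iset vJ (ILit 0)) (iset vHi (ILit 0)))))
      (For vT vM 0 merge_body).

Definition copy_back_body : cmd := ISet tA (sc vL) (IGet tB (sc vL)).

Definition merge_sort : cmd :=
  Seq (iset vW (ILit 1))
    (While (ILt (sc vW) (sc vM))
      (Seq merge_pass (Seq (For vL vM 0 copy_back_body)
         (iset vW (IAdd (sc vW) (sc vW)))))).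

Definition prefix_body : cmd :=
  Seq (RSet vSc (ILit 0) (RAdd (RGet vSc (ILit 0)) (RGet tC (IGet tA (sc vL)))))
 (Seq (RSet vSr (ILit 0)
        (RAdd (RGet vSr (ILit 0)) (RGet ar (IAdd (sc vB) (IGet tA (sc vL))))))
 (Seq (RSet tQ (sc vL) (RAdd (RGet vSc (ILit 0)) (RSqrt (RGet vSr (ILit 0)))))
  (If (RLe (RGet tQ (sc vL)) (RGet tQ (ISub (sc vBest) (ILit 1))))
    (iset vBest (IAdd (sc vL) (ILit 1))) Skip))).

(** The minimizer starts at 0, which makes it right for an empty J3: marking then
    changes nothing.  Otherwise the truncated predecessor sends the first
    comparison to the value just written, so the register becomes 1. *)
Definition prefixes : cmd :=
  Seq (Seq (iset vBest (ILit 0))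
      (Seq (RSet vSc (ILit 0) (RLit 0)) (RSet vSr (ILit 0) (RLit 0))))
      (For vL vM 0 prefix_body).

Definition mark_body : cmd := ISet tY (IGet tA (sc vL)) (ILit 1).
Definition mark : cmd := For vL vBest 0 mark_body.

Definition output_body : cmd :=
  Seq (ISet aY here (IGet tY (sc vL)))
 (Seq (ISet aOrd here (IGet tA (sc vL)))
      (RSet aQ here (RGet tQ (sc vL)))).

(** Results are moved to the output arrays only at the end of a pair, in a loop
    that writes inside the block of that pair; earlier blocks are thereby
    visibly untouched.  Junk beyond the size of J3 stays inside the block. *)
Definition output : cmd :=
  Seq (Seq (ISet aLen (sc vP) (sc vM)) (ISet aMstar (sc vP) (sc vBest)))
      (For vL aSize 1 output_body).

Definition next_block : cmd := iset vB (IAdd (sc vB) (IGet aSize (ILit 1))).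

Definition solve_pair : cmd :=
  Seq classify (Seq merge_sort (Seq prefixes (Seq mark (Seq output next_block)))).

Definition count_body : cmd := iset vN (IAdd (sc vN) (IGet aSize (ILit 2))).
Definition count_pairs : cmd :=
  Seq (iset vN (ILit 0)) (For vP aSize 0 count_body).

(** Index arithmetic has no product: the number of pairs is obtained by repeated
    addition, and the address of a block by adding |J| after every pair. *)
Definition algorithm2 : cmd :=
  Seq count_pairs (Seq (iset vB (ILit 0)) (For vP vN 0 solve_pair)).

Section Phases.
Variable R : realType.
Implicit Types s : state R.

(** Coefficients of the subproblem whose block starts at the address in [vB]. *)
Definition net s (x : nat) : R := rmem s aq (imem s vB 0 + x)%N - rmem s au x.
Definition wgt s (x : nat) : R := rmem s ar (imem s vB 0 + x)%N.
Definition in2 s (x : nat) : bool := (net s x < 0) && (wgt s x <= 0).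
Definition in3 s (x : nat) : bool := (net s x < 0) && (0 < wgt s x).

Record classified s (l : nat) s' : Prop := Classified {
  cl_net : forall x, (x < l)%N -> rmem s' tC x = net s x;
  cl_key : forall x, (x < l)%N -> rmem s' tKey x = net s x / wgt s x;
  cl_y : forall x, (x < l)%N -> imem s' tY x = in2 s x;
  cl_ord : slice (imem s' tA) 0 (imem s' vM 0) = filter (in3 s) (iota 0 l)
}.

Lemma filter_iotaS (p : pred nat) l :
  filter p (iota 0 l.+1) = filter p (iota 0 l) ++ (if p l then [:: l] else [::]).
Proof. by rewrite -addn1 iotaD filter_cat. Qed.

Lemma runs_classify s :
  runs classify s (wcost (iset vM (ILit 0)) +
                   for_cost (imem s aSize 1) (wcost classify_body))
    (classified s (imem s aSize 1)).
Proof.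
apply/runs_seq/runs_straight => //=.
rewrite -[imem s aSize 1]/(imem (State (upd (imem s) vM 0 0) (rmem s)) aSize 1).
apply: (@runs_for _ _ _ _ _ _ _ (classified s)) => //.
move=> l s1 [F G] lt il [h1 h2 h3 h4].
have Eb : imem s1 vB 0 = imem s vB 0 := F vB isT 0.
have En : rmem s1 aq (imem s vB 0 + l)%N - rmem s1 au l = net s l.
  by rewrite (G aq isT) (G au isT).
have Er : rmem s1 ar (imem s vB 0 + l)%N = wgt s l := G ar isT _.
apply: runs_straight => //.
rewrite /= /upd /= il eqxx Eb En Er.
have [c0|c0] := leP 0 (net s l); last have [r0|r0] := leP (wgt s l) 0.
- split=> [x|x|x|]; rewrite ?filter_iotaS /= /upd /=; try (
    rewrite ltnS leq_eqVlt => /predU1P[->|xl]; rewrite ?eqxx ?(ltn_eqF xl); auto).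
    by rewrite /in2 ltNge c0.
  by rewrite h4 /in3 ltNge c0 cats0.
- split=> [x|x|x|]; rewrite ?filter_iotaS /= /upd /=; try (
    rewrite ltnS leq_eqVlt => /predU1P[->|xl]; rewrite ?eqxx ?(ltn_eqF xl); auto).
    by rewrite /in2 c0 r0.
  by rewrite h4 /in3 (ltNge 0) r0 andbF cats0.
- split=> [x|x|x|]; rewrite ?filter_iotaS /= /upd /=; try (
    rewrite ltnS leq_eqVlt => /predU1P[->|xl]; rewrite ?eqxx ?(ltn_eqF xl); auto).
    by rewrite /in2 leNgt r0 andbF.
  rewrite -h4 /in3 c0 r0 addn1 slice_rcons eqxx cats1.
  by congr rcons; apply: eq_slice => x /andP[_ xl]; rewrite ltn_eqF.
Qed.

(** The keys are named by a function of their own because the relation used by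
    [pass] must be literally the same in all rounds of the sort. *)
Lemma runs_merge_pass s (key : nat -> R) :
  rmem s tKey =1 key -> (0 < imem s vW 0)%N ->
  let leK x y := key x <= key y in
  let m := imem s vM 0 in
  runs merge_pass s (12 + for_cost m (wcost merge_body))
    (fun s' => slice (imem s' tB) 0 m =
               pass leK m (imem s vW 0) (slice (imem s tA) 0 m)).
Proof.
move=> keyE w0 leK m.
have leK_total : total leK by move=> x y; apply: le_total.
apply/runs_seq/(@runs_straight _ (Seq _ _)) => //=.
set s0 := State _ _.
set target := pass _ _ _ _.
rewrite -[m]/(imem s0 vM 0).
pose inv t s1 := merging leK (imem s tA) (imem s vW 0) m target (imem s1 tB) t
  (imem s1 vI 0) (imem s1 vMid 0) (imem s1 vJ 0) (imem s1 vHi 0).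
apply: (@runs_for _ _ _ _ _ _ _ inv) => //.
- exact: merging_init.
- move=> t s1 [F G] lt it I1.
  rewrite -[imem s0 vM 0]/m in lt.
  have EW : imem s1 vW 0 = imem s vW 0 := F vW isT 0.
  have EM : imem s1 vM 0 = m := F vM isT 0.
  have reload : runs merge_reload s1 (wcost merge_reload)
      (fun s2 => inv t s2 /\ (t < imem s2 vHi 0)%N).
    apply: runs_straight => //; rewrite /inv /= it.
    case: (leqP (imem s1 vHi 0) t) => [ht|//].
    rewrite /upd /= EW EM -!minnE; split; first exact: merging_reload I1.
    by case: I1 => *; lia.
  apply: (@runs_seq _ merge_reload merge_pick _ (wcost merge_reload)).
  move: (runs_frame reload); apply: runs_imp => s2 [[F2 G2] [I2 t2]].
  apply: runs_straight => //.
  have EK x : rmem s2 tKey x = key x by rewrite -keyE (G2 tKey) // (G tKey).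
  have EA x : imem s2 tA x = imem s tA x by rewrite (F2 tA) // (F tA).
  rewrite /inv /= !EA !EK (F2 vT isT) it /upd.
  case: ifP => [/andP[]|/negbT].
  + rewrite -ltnNge negb_and !negbK => im jk; rewrite /= addn1.
    apply: merging_left => // jh.
    by case/orP: jk => //; rewrite leqNgt jh.
  + rewrite -!ltnNge negb_and negbK => jk; rewrite /= addn1.
    apply: merging_right => // im.
    by move: jk; rewrite im /= => /andP.
- by move=> s1 _ /merging_end.
Qed.

(** A round costs time linear in [m] and doubles the block length, so there are
    at most [up_log 2 m] rounds: the logarithm of the bound comes from here. *)
Definition sort_cost (m : nat) : nat :=
  (3 + (up_log 2 m * (6 + (12 + for_cost m (wcost merge_body) +
                           (for_cost m (wcost copy_back_body) + 7))) + 6))%N.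

Lemma runs_copy_back s :
  let m := imem s vM 0 in
  runs (For vL vM 0 copy_back_body) s (for_cost m (wcost copy_back_body))
    (fun s' => slice (imem s' tA) 0 m = slice (imem s tB) 0 m).
Proof.
apply: (@runs_for _ _ _ _ _ _ _
  (fun l s1 => forall x, (x < l)%N -> imem s1 tA x = imem s tB x)) => //.
- move=> l s1 [F _] lt il I1; apply: runs_straight => // x.
  rewrite /= /upd /= il ltnS leq_eqVlt => /predU1P[->|xl].
    by rewrite eqxx (F tB).
  by rewrite (ltn_eqF xl) I1.
- by move=> s1 _ I1; apply: eq_slice => x /andP[_]; apply: I1.
Qed.

Lemma runs_merge_sort s :
  let leK x y := rmem s tKey x <= rmem s tKey y in
  let m := imem s vM 0 in
  runs merge_sort s (sort_cost m) (fun s' =>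
    perm_eq (slice (imem s' tA) 0 m) (slice (imem s tA) 0 m) /\
    sorted leK (slice (imem s' tA) 0 m)).
Proof.
move=> leK m.
have leK_total : total leK by move=> x y; apply: le_total.
apply: (@runs_seq _ (iset vW (ILit 1)) _ _ 3); apply: (@runs_straight _ (iset _ _)) => //=.
set s0 := State _ _.
pose A s1 := slice (imem s1 tA) 0 m.
apply: (@runs_while _ _ _ _ _ (fun k s1 => exists e,
  [/\ imem s1 vW 0 = 2 ^ e, k = up_log 2 m - e, perm_eq (A s1) (A s)
    & blockwise_sorted leK (2 ^ e) (A s1)]%N)).
- exists 0; rewrite subn0 expn0; split=> //; exact: blockwise_sorted1.
- move=> k s1 [F G] [e [we -> pe rs]]; rewrite /= we (F vM isT) -ltnNge => lt.
  rewrite -[imem s0 vM 0]/m in lt.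
  (* While the block length 2 ^ e is below m, rounds remain to be paid for. *)
  have e_lt : (e < up_log 2 m)%N.
    rewrite ltnNge; apply/negP => le.
    by have := leq_pexp2l (isT : 0 < 2)%N le; have := @up_logP 2 m isT; lia.
  exists (up_log 2 m - e.+1)%N; first lia.
  have w0 : (0 < imem s1 vW 0)%N by rewrite we expn_gt0.
  have EM : imem s1 vM 0 = m := F vM isT 0.
  apply: runs_seq; have := runs_merge_pass (G tKey isT) w0; rewrite EM => /runs_frame.
  apply: runs_imp => s2 [[F2 G2] E2].
  apply: runs_seq; have := runs_copy_back s2; rewrite (F2 vM isT) EM => /runs_frame.
  apply: runs_imp => s3 [[F3 G3] E3]; apply: runs_straight => //.
  exists e.+1; rewrite /= /upd /= (F3 vW isT) (F2 vW isT) we addnn -mul2n -expnS.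
  have EA : A s3 = pass leK m (2 ^ e) (A s1).
    by rewrite /A E3 E2 we.
  split=> //; rewrite -[A _]/(A s3) EA.
    by apply: perm_trans pe; apply: perm_pass; rewrite ?expn_gt0 // size_slice subn0.
  rewrite expnS mul2n -addnn; apply: pass_sorted; rewrite ?expn_gt0 // size_slice subn0 //.
- move=> k s1 [F G] [e [we _ pe rs]]; rewrite /= we (F vM isT) -ltnNge -leqNgt => le.
  split=> //; apply: sorted_of_blockwise rs.
  by rewrite size_slice subn0.
Qed.

Definition Qval s (x : nat) : R :=
  \sum_(j <- slice (imem s tA) 0 x) rmem s tC j +
  Num.sqrt (\sum_(j <- slice (imem s tA) 0 x) wgt s j).

Record minimized s m s' : Prop := Minimized {
  mi_Q : forall x, (x < m)%N -> rmem s' tQ x = Qval s x.+1;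
  mi_pos : (0 < m)%N -> (0 < imem s' vBest 0)%N;
  mi_le : (imem s' vBest 0 <= m)%N;
  mi_min : forall x, (x < m)%N -> rmem s' tQ (imem s' vBest 0).-1 <= rmem s' tQ x
}.

Lemma runs_prefixes s :
  let m := imem s vM 0 in
  runs prefixes s (9 + for_cost m (wcost prefix_body)) (minimized s m).
Proof.
move=> m; apply/runs_seq/(@runs_straight _ (Seq _ _)) => //=.
set s0 := State _ _.
rewrite -[m]/(imem s0 vM 0).
pose inv l s1 := [/\ minimized s l s1,
  rmem s1 vSc 0 = \sum_(j <- slice (imem s tA) 0 l) rmem s tC j
  & rmem s1 vSr 0 = \sum_(j <- slice (imem s tA) 0 l) wgt s j].
apply: (@runs_for _ _ _ _ _ _ _ inv) => //.
- by split=> //; rewrite /= /upd /= big_nil.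
- move=> l s1 [F G] lt il [[h1 h2 h3 h4] hc hr]; apply: runs_straight => //.
  have EA : imem s1 tA l = imem s tA l := F tA isT l.
  have EC x : rmem s1 tC x = rmem s tC x := G tC isT x.
  have EB : imem s1 vB 0 = imem s vB 0 := F vB isT 0.
  have EW x : rmem s1 ar (imem s vB 0 + x)%N = wgt s x := G ar isT _.
  rewrite /= /upd /= !il !EA EC EB EW hc hr eqxx.
  have Sc : \sum_(j <- slice (imem s tA) 0 l) rmem s tC j + rmem s tC (imem s tA l) =
    \sum_(j <- slice (imem s tA) 0 l.+1) rmem s tC j.
    by rewrite slice_rcons -cats1 big_cat big_seq1.
  have Sr : \sum_(j <- slice (imem s tA) 0 l) wgt s j + wgt s (imem s tA l) =
    \sum_(j <- slice (imem s tA) 0 l.+1) wgt s j.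
    by rewrite slice_rcons -cats1 big_cat big_seq1.
  rewrite Sc Sr -/(Qval s l.+1).
  have best_lt : (0 < l)%N -> ((imem s1 vBest 0).-1 < l)%N by move=> /h2; lia.
  have Qx x : (x < l)%N -> (if x == l then Qval s l.+1 else rmem s1 tQ x) = rmem s1 tQ x.
    by move=> xl; rewrite (ltn_eqF xl).
  rewrite subn1; case: ifP => [le|/negbT nle].
    split=> //; split; rewrite /= /upd /= ?addn1 //= => x.
      rewrite ltnS leq_eqVlt => /predU1P[->|xl]; first by rewrite eqxx.
      by rewrite Qx // h1.
    rewrite eqxx ltnS leq_eqVlt => /predU1P[->|xl]; first by rewrite eqxx.
    have l0 : (0 < l)%N by lia.
    rewrite (Qx x) //; rewrite (Qx _ (best_lt l0)) in le.
    exact: le_trans le (h4 _ xl).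
  (* At l = 0 the value would be compared with itself, and the test succeed. *)
  have l0 : (0 < l)%N.
    rewrite lt0n; apply: contra nle => /eqP l0; move: h3; rewrite l0 leqn0 => /eqP ->.
    by rewrite eqxx.
  rewrite (Qx _ (best_lt l0)) -ltNge in nle.
  split=> //; split; rewrite /= /upd /=; [|by move=> _; apply: h2|lia|].
    move=> x; rewrite ltnS leq_eqVlt => /predU1P[->|xl]; first by rewrite eqxx.
    by rewrite Qx // h1.
  move=> x; rewrite ltnS leq_eqVlt (Qx _ (best_lt l0)) => /predU1P[->|xl].
    by rewrite eqxx ltW.
  by rewrite Qx // h4.
- by move=> s1 _ [].
Qed.

End Phases.

(** * One pair of indices *)

Section Pair.
Variable R : realType.
Implicit Types s : state R.

Lemma runs_mark s :
  let b := imem s vBest 0 in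
  runs mark s (for_cost b (wcost mark_body)) (fun s' => forall x,
    imem s' tY x = if x \in slice (imem s tA) 0 b then 1%N else imem s tY x).
Proof.
move=> b.
apply: (@runs_for _ _ _ _ _ _ _ (fun l s1 => forall x,
  imem s1 tY x = if x \in slice (imem s tA) 0 l then 1%N else imem s tY x)) => //.
move=> l s1 [F _] lt il I1; apply: runs_straight => // x.
rewrite /= /upd /= il slice_rcons mem_rcons inE (F tA) //.
by case: eqP => //= _; apply: I1.
Qed.

Record written s s' : Prop := Written {
  wr_new : forall x, (x < imem s aSize 1)%N ->
    [/\ imem s' aY (imem s vB 0 + x)%N = imem s tY x,
        imem s' aOrd (imem s vB 0 + x)%N = imem s tA x
      & rmem s' aQ (imem s vB 0 + x)%N = rmem s tQ x];
  wr_old : forall x, (x < imem s vB 0)%N ->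
    [/\ imem s' aY x = imem s aY x,
        imem s' aOrd x = imem s aOrd x
      & rmem s' aQ x = rmem s aQ x];
  wr_len : forall p, imem s' aLen p =
    if p == imem s vP 0 then imem s vM 0 else imem s aLen p;
  wr_best : forall p, imem s' aMstar p =
    if p == imem s vP 0 then imem s vBest 0 else imem s aMstar p
}.

Lemma runs_output s :
  runs output s (10 + for_cost (imem s aSize 1) (wcost output_body)) (written s).
Proof.
apply/runs_seq/(@runs_straight _ (Seq _ _)) => //=.
set s0 := State _ _.
set B := imem s vB 0.
rewrite -[imem s aSize 1]/(imem s0 aSize 1).
pose inv l s1 :=
  (forall x, (x < l)%N ->
    [/\ imem s1 aY (B + x)%N = imem s tY x,
        imem s1 aOrd (B + x)%N = imem s tA x
      & rmem s1 aQ (B + x)%N = rmem s tQ x]) /\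
  (forall x, (x < B)%N ->
    [/\ imem s1 aY x = imem s aY x,
        imem s1 aOrd x = imem s aOrd x
      & rmem s1 aQ x = rmem s aQ x]).
apply: (@runs_for _ _ _ _ _ _ _ inv) => //.
- move=> l s1 [F G] lt il [new old]; apply: runs_straight => //.
  have EB : imem s1 vB 0 = B := F vB isT 0.
  rewrite /inv /= /upd /= il EB; split=> x.
    rewrite ltnS leq_eqVlt => /predU1P[->|xl]; rewrite /= ?eqxx /=.
      by split; rewrite ?(F tY isT) ?(F tA isT) ?(G tQ isT).
    by rewrite /= eqn_add2l (ltn_eqF xl); apply: new.
  move=> xB; have -> : (x == B + l)%N = false by lia.
  exact: old.
- move=> s1 [F G] [new old]; split=> // p.
    by rewrite (F aLen) // /= /upd /=; case: eqP.
  by rewrite (F aMstar) // /= /upd /=; case: eqP.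
Qed.

(** The outcome of a run for one pair, phrased with addresses in place of elements
    of the index types: [L] is the sorted list of positions of J3, and block
    [base] of the output arrays holds the results. *)
Record solved (n : nat) (c w : nat -> R) (base p : nat) (L : seq nat) s : Prop :=
  Solved {
  so_perm : perm_eq L (filter (fun x => (c x < 0) && (0 < w x)) (iota 0 n));
  so_sorted : sorted (fun x y => c x / w x <= c y / w y) L;
  so_len : imem s aLen p = size L;
  so_ord : [seq imem s aOrd (base + l)%N | l <- iota 0 (size L)] = L;
  so_Q : forall m, (1 <= m <= size L)%N -> rmem s aQ (base + m.-1)%N =
    \sum_(j <- take m L) c j + Num.sqrt (\sum_(j <- take m L) w j);
  so_best : (0 < size L)%N -> (1 <= imem s aMstar p <= size L)%N;
  so_min : forall m, (1 <= m <= size L)%N ->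
    rmem s aQ (base + (imem s aMstar p).-1)%N <= rmem s aQ (base + m.-1)%N;
  so_y : forall x, (x < n)%N -> imem s aY (base + x)%N =
    ((c x < 0) && (w x <= 0)) || (x \in take (imem s aMstar p) L)
}.

Lemma solved_size n c w base p L s : solved n c w base p L s -> (size L <= n)%N.
Proof.
case=> /perm_size -> *; rewrite size_filter.
by apply: leq_trans (count_size _ _) _; rewrite size_iota.
Qed.

(** Later pairs write at higher addresses only, so results persist. *)
Lemma solved_ext n c w base p L s s' :
  imem s' aLen p = imem s aLen p -> imem s' aMstar p = imem s aMstar p ->
  (forall x, (base <= x < base + n)%N ->
    [/\ imem s' aY x = imem s aY x, imem s' aOrd x = imem s aOrd x
      & rmem s' aQ x = rmem s aQ x]) ->
  solved n c w base p L s -> solved n c w base p L s'.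
Proof.
move=> El Eb E S; have sz := solved_size S; case: S => h1 h2 h3 h4 h5 h6 h7 h8.
have EQ m : (1 <= m <= size L)%N -> rmem s' aQ (base + m.-1)%N = rmem s aQ (base + m.-1)%N.
  by move=> /andP[m0 mL]; case: (E (base + m.-1)%N) => //; lia.
split=> //; rewrite ?El ?Eb //.
- rewrite -[RHS]h4; apply/eq_in_map => x; rewrite mem_iota => xL.
  by case: (E (base + x)%N) => //; lia.
- by move=> m mL; rewrite EQ // h5.
- by move=> m mL; rewrite !EQ ?h7 //; apply: h6; lia.
- by move=> x xn; case: (E (base + x)%N) => [|->]; [lia|rewrite h8].
Qed.

Definition pair_cost (n : nat) : nat :=
  (3 + for_cost n (wcost classify_body) +
    (sort_cost n + (9 + for_cost n (wcost prefix_body) +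
      (for_cost n (wcost mark_body) +
        (10 + for_cost n (wcost output_body) + wcost next_block)))))%N.

Lemma leq_for_cost m n T : (m <= n)%N -> (for_cost m T <= for_cost n T)%N.
Proof. by move=> le; rewrite leq_add2r leq_mul2r le orbT. Qed.

Lemma leq_sort_cost m n : (m <= n)%N -> (sort_cost m <= sort_cost n)%N.
Proof.
move=> le; rewrite /sort_cost leq_add2l leq_add2r; apply: leq_mul.
  exact: leq_up_log.
have := leq_for_cost (wcost merge_body) le; have := leq_for_cost (wcost copy_back_body) le; lia.
Qed.

(** The last two clauses confine the writes to the current pair, which is what
    lets the loop over all pairs keep the earlier results. *)
Lemma runs_solve_pair s :
  let n := imem s aSize 1 in let B := imem s vB 0 in let p := imem s vP 0 in
  runs solve_pair s (pair_cost n) (fun s' =>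
    [/\ exists L, solved n (net s) (wgt s) B p L s',
        imem s' vB 0 = (B + n)%N,
        forall x, (x < B)%N -> [/\ imem s' aY x = imem s aY x,
          imem s' aOrd x = imem s aOrd x & rmem s' aQ x = rmem s aQ x]
      & forall p', p' != p -> imem s' aLen p' = imem s aLen p' /\
                              imem s' aMstar p' = imem s aMstar p']).
Proof.
move=> n B p.
apply: runs_seq; move: (runs_frame (runs_classify s)).
apply: runs_imp => s1 [[F1 G1] [cnet ckey cy cord]].
set m := imem s1 vM 0 in cord *.
have mn : (m <= n)%N.
  have <- : size (slice (imem s1 tA) 0 m) = m by rewrite size_slice subn0.
  rewrite cord size_filter.
  by apply: leq_trans (count_size _ _) _; rewrite size_iota.
apply/runs_seq/(runs_le (leq_sort_cost mn)); move: (runs_frame (runs_merge_sort s1)).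
apply: runs_imp => s2 [[F2 G2] [perm2 sort2]].
rewrite -/m in perm2 sort2.
apply: runs_seq; apply: (@runs_le _ _ _ (9 + for_cost (imem s2 vM 0) (wcost prefix_body))).
  by rewrite leq_add2l leq_for_cost // (F2 vM).
move: (runs_frame (runs_prefixes s2)).
apply: runs_imp => s3 [[F3 G3]]; rewrite (F2 vM isT) -/m => -[mQ mpos mle mmin].
apply/runs_seq/(runs_le (leq_for_cost _ (leq_trans mle mn))).
move: (runs_frame (runs_mark s3)); apply: runs_imp => s4 [[F4 G4] y4].
have n4 : imem s4 aSize 1 = n.
  by rewrite (F4 aSize) // (F3 aSize) // (F2 aSize) // (F1 aSize).
have B4 : imem s4 vB 0 = B.
  by rewrite (F4 vB) // (F3 vB) // (F2 vB) // (F1 vB).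
have p4 : imem s4 vP 0 = p.
  by rewrite (F4 vP) // (F3 vP) // (F2 vP) // (F1 vP).
have m4 : imem s4 vM 0 = m.
  by rewrite (F4 vM) // (F3 vM) // (F2 vM).
have b4 : imem s4 vBest 0 = imem s3 vBest 0 by rewrite (F4 vBest).
have A4 : imem s4 tA =1 imem s2 tA by move=> x; rewrite (F4 tA) // (F3 tA).
have Q4 : rmem s4 tQ =1 rmem s3 tQ by move=> x; rewrite (G4 tQ).
apply: runs_seq; move: (runs_frame (runs_output s4)); rewrite n4.
apply: runs_imp => s5 [[F5 G5] [new old len best]].
rewrite {}n4 {}B4 {}p4 {}m4 {}b4 in new old len best *.
apply: runs_straight => //.
set L := slice (imem s2 tA) 0 m in perm2 sort2.
have szL : size L = m by rewrite size_slice subn0.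
have LP : perm_eq L (filter (in3 s) (iota 0 n)) by rewrite -cord.
have Ln x : x \in L -> (x < n)%N.
  by rewrite (perm_mem LP) mem_filter mem_iota => /andP[_ /andP[]].
set b := imem s3 vBest 0 in mpos mle mmin new best.
have bestp : imem s5 aMstar p = b by rewrite best eqxx.
have Qnew x : (x < m)%N -> rmem s5 aQ (B + x)%N = rmem s3 tQ x.
  by move=> xm; case: (new x) => [|_ _ ->]; [lia|rewrite Q4].
split=> /=.
- exists L; apply: (@solved_ext _ _ _ _ _ _ s5) => //; split=> //.
  + rewrite -(@eq_in_sorted _ [in L] (fun x y => rmem s1 tKey x <= rmem s1 tKey y)) //.
      by move=> x y xL yL; rewrite !ckey ?Ln.
  + by rewrite len eqxx szL.
  + rewrite szL /L /slice subn0; apply/eq_in_map => x; rewrite mem_iota => xm.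
    by case: (new x) => [|_ -> _]; [lia|rewrite A4].
  + move=> x /andP[x0]; rewrite szL => xm.
    rewrite Qnew ?mQ; [|lia|lia]; rewrite prednK // /Qval.
    rewrite /L take_slice add0n (minn_idPl xm).
    (* The prefix contains true positions only, where the work arrays are valid. *)
    have sub : {subset slice (imem s2 tA) 0 x <= L}.
      by move=> j; rewrite -(minn_idPl xm) -[x in minn x]add0n -take_slice; apply: mem_take.
    congr (_ + Num.sqrt _); apply: eq_big_seq => j /sub /Ln jn.
      by rewrite (G2 tC) // cnet.
    by rewrite /wgt (F2 vB) // (F1 vB) // (G2 ar) // (G1 ar).
  + by rewrite bestp szL => m0; rewrite mle mpos.
  + move=> x; rewrite szL bestp => /andP[x0 xm].
    have m0 : (0 < m)%N by lia.
    have b0 := mpos m0.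
    rewrite !Qnew; [|lia|lia]; apply: mmin; lia.
  + move=> x xn; case: (new x xn) => -> _ _; rewrite y4 bestp.
    rewrite /L take_slice add0n (minn_idPl mle).
    rewrite (@eq_slice _ (imem s3 tA) (imem s2 tA)); last by move=> z _; rewrite (F3 tA).
    case: ifP => _; first by rewrite orbT.
    by rewrite orbF (F3 tY) // (F2 tY) // cy.
- by rewrite /upd /= (F5 vB) // (F5 aSize) // (F4 vB) // (F3 vB) // (F2 vB) // (F1 vB) //
    (F4 aSize) // (F3 aSize) // (F2 aSize) // (F1 aSize).
- move=> x xB; case: (old x xB) => oy oo oq; rewrite /upd /= oy oo oq.
  rewrite (F4 aY) // (F3 aY) // (F2 aY) // (F1 aY) //.
  rewrite (F4 aOrd) // (F3 aOrd) // (F2 aOrd) // (F1 aOrd) //.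
  by rewrite (G4 aQ) // (G3 aQ) // (G2 aQ) // (G1 aQ).
- move=> p' np; rewrite /upd /= len best (negPf np).
  rewrite (F4 aLen) // (F3 aLen) // (F2 aLen) // (F1 aLen) //.
  by rewrite (F4 aMstar) // (F3 aMstar) // (F2 aMstar) // (F1 aMstar).
Qed.

End Pair.

(** * From addresses to index types *)

Section Transfer.
Variable R : realType.

Lemma rank_lt (T : finType) (x : T) : (rank x < #|T|)%N.
Proof. exact: ltn_ord. Qed.

Lemma rank_nth (T : finType) (x0 : T) x : (x < #|T|)%N -> rank (nth x0 (enum T) x) = x.
Proof.
move=> xT; rewrite /rank -[x in LHS]/(nat_of_ord (Ordinal xT)).
by rewrite -(enum_val_nth x0) enum_valK.
Qed.

(** Translation along the bijection [rank] between J and the positions below |J|: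
    the order of Step 3 is the image of [L], and the assignment is 1 on J2 and
    on the first [mstar] elements.  Nonnegativity of [w] turns the test
    [w <= 0] made by the program into the condition [w = 0] of Step 1. *)
Lemma solved_run (J : finType) (j0 : J) (c w : J -> R) (cn wn : nat -> R)
    base p L (s : state R) :
  (forall j, 0 <= w j) ->
  (forall j, cn (rank j) = c j) -> (forall j, wn (rank j) = w j) ->
  solved #|J| cn wn base p L s ->
  exists (sJ : seq J) (y : J -> bool),
    [/\ algorithm2_run c w sJ (fun m => rmem s aQ (base + m.-1)%N)
          (imem s aMstar p) y,
        imem s aLen p = size sJ,
        map (fun l => imem s aOrd (base + l)%N) (iota 0 (size sJ)) =
          map (@rank J) sJ
      & forall j, imem s aY (base + rank j)%N = y j :> nat].
Proof.
move=> w_ge0 cE wE [hperm hsort hlen hord hQ hbest hmin hy].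
set b := imem s aMstar p in hbest hmin hy *.
pose f x := nth j0 (enum J) x.
have fK j : f (rank j) = j by apply: nth_enum_rank.
have LE x : x \in L = [&& cn x < 0, 0 < wn x & (x < #|J|)%N].
  by rewrite (perm_mem hperm) mem_filter mem_iota -andbA.
have rankf x : x \in L -> rank (f x) = x by rewrite LE => /and3P[_ _]; apply: rank_nth.
have cf x : x \in L -> c (f x) = cn x by move=> xL; rewrite -cE rankf.
have wf x : x \in L -> w (f x) = wn x by move=> xL; rewrite -wE rankf.
have uL : uniq L by rewrite (perm_uniq hperm) filter_uniq // iota_uniq.
have J3E j : (j \in J3 c w) = (c j < 0) && (0 < w j).
  rewrite !inE [0 < w j]lt_def w_ge0 andbT.
  by case: (leP 0 (c j)).
have LJ j : (rank j \in L) = (j \in J3 c w).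
  by rewrite LE cE wE rank_lt andbT J3E.
exists (map f L), (fun j => ((c j < 0) && (w j <= 0)) || (rank j \in take b L)).
have mapL (s' : seq nat) j : {subset s' <= L} -> (j \in map f s') = (rank j \in s').
  move=> sub; apply/mapP/idP => [[x xs ->]|js]; first by rewrite rankf ?sub.
  by exists (rank j).
have takeL m : {subset take m L <= L} by move=> x; apply: mem_take.
split.
- split.
  + move=> j; rewrite inE => cj; rewrite ltNge cj /=.
    by apply/negP => /takeL; rewrite LE cE ltNge cj.
  + by move=> j; rewrite inE => /andP[-> /eqP ->]; rewrite lexx.
  + apply: uniq_perm; rewrite ?enum_uniq //.
      by rewrite map_inj_in_uniq // => x y xL yL /(congr1 (@rank J)); rewrite !rankf.
    by move=> j; rewrite mem_enum mapL // LJ.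
  + rewrite sorted_map -[X in is_true X](@eq_in_sorted _ [in L] (fun x y => cn x / wn x <= cn y / wn y)) //.
    by move=> x y xL yL; rewrite /= !cf ?wf.
  + move=> m; rewrite size_map => mL; rewrite hQ // /Q_of -map_take !big_map.
    by congr (_ + Num.sqrt _); apply: eq_big_seq => x /takeL xL; rewrite ?cf ?wf.
  + by rewrite size_map => L0; split; [apply: hbest|apply: hmin].
  + by move=> j; rewrite -map_take mapL // => ->; rewrite orbT.
  + move=> j; rewrite -map_drop mapL; last by move=> x; apply: mem_drop.
    move=> jd; have jL : rank j \in L by apply: mem_drop jd.
    move: (jL); rewrite LE cE wE => /and3P[_ wj _]; rewrite leNgt wj andbF /=.
    have : uniq (take b L ++ drop b L) by rewrite cat_take_drop.
    rewrite cat_uniq => /and3P[_ /hasPn h _]; apply/negbTE.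
    exact: h _ jd.
- by rewrite size_map.
- rewrite size_map hord -map_comp -[LHS]map_id; apply/eq_in_map => x xL /=.
  by rewrite rankf.
- by move=> j; rewrite hy ?rank_lt // cE wE.
Qed.

Lemma runs_count_pairs (s : state R) :
  let N := (imem s aSize 0 * imem s aSize 2)%N in
  runs count_pairs s (3 + for_cost (imem s aSize 0) (wcost count_body))
    (fun s' => imem s' vN 0 = N).
Proof.
move=> N; apply/runs_seq/(@runs_straight _ (iset _ _)) => //=.
set s0 := State _ _; rewrite -[imem s aSize 0]/(imem s0 aSize 0).
apply: (@runs_for _ _ _ _ _ _ _
  (fun l s1 => imem s1 vN 0 = l * imem s aSize 2)%N) => //.
move=> l s1 [F _] lt il I1; apply: runs_straight => //.
by rewrite /= /upd /= I1 (F aSize) // mulSnr.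
Qed.

Definition total_cost (I n K : nat) : nat :=
  (3 + for_cost I (wcost count_body) + (3 + for_cost (I * K) (pair_cost n)))%N.

Lemma runs_algorithm2 (s : state R) :
  let I := imem s aSize 0 in let n := imem s aSize 1 in
  let K := imem s aSize 2 in
  runs algorithm2 s (total_cost I n K) (fun s' => forall p, (p < I * K)%N ->
    exists c w L, [/\ forall x, c x = rmem s aq (p * n + x)%N - rmem s au x,
      forall x, w x = rmem s ar (p * n + x)%N
      & solved n c w (p * n)%N p L s']).
Proof.
move=> I n K.
apply: runs_seq; move: (runs_frame (runs_count_pairs s)).
apply: runs_imp => s1 [[F1 G1] N1].
apply: (@runs_seq _ _ _ _ 3); apply: (@runs_straight _ (iset _ _)) => //=.
set s2 := State _ _.
have N2 : imem s2 vN 0 = (I * K)%N := N1.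
have n2 : imem s2 aSize 1 = n := F1 aSize isT 1.
rewrite -N2.
pose inv p s' := imem s' vB 0 = (p * n)%N /\ forall p', (p' < p)%N ->
   exists c w L, [/\ forall x, c x = rmem s aq (p' * n + x)%N - rmem s au x,
      forall x, w x = rmem s ar (p' * n + x)%N
      & solved n c w (p' * n)%N p' L s'].
apply: (@runs_for _ _ _ _ _ _ _ inv) => //; last by move=> s3 _ [].
move=> p s3 [F G] _ ps3 [B3 old].
have n3 : imem s3 aSize 1 = n by rewrite (F aSize).
have := runs_solve_pair s3; rewrite n3 B3 ps3.
apply: runs_imp => s4 [[L S] B4 out arr]; split; first by rewrite mulSnr.
move=> p'; rewrite ltnS leq_eqVlt => /predU1P[->|lt].
  exists (net s3), (wgt s3), L; split; last exact: solved_ext S.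
    by move=> x; rewrite /net B3 (G aq) // (G au) //= (G1 aq) // (G1 au).
  by move=> x; rewrite /wgt B3 (G ar) //= (G1 ar).
have [c [w [L' [cE wE S']]]] := old p' lt; exists c, w, L'; split=> //.
apply: solved_ext S'.
- by rewrite /= /upd /=; case: (arr p') => //; rewrite ltn_eqF.
- by rewrite /= /upd /=; case: (arr p') => //; rewrite ltn_eqF.
- move=> x /andP[_ xl]; apply: out; apply: leq_trans xl _.
  by rewrite -mulSnr leq_mul2r lt orbT.
Qed.

(** * The asymptotic bound *)

Lemma for_cost_le N T x : (0 < x)%N -> (N <= x)%N ->
  (for_cost N T <= (T + 21) * x)%N.
Proof. rewrite /for_cost; nia. Qed.

Definition pair_factor : nat :=
  (3 + (wcost classify_body + 21) +
   (9 + (18 + (wcost merge_body + 21) + (wcost copy_back_body + 21) + 7) +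
    (9 + (wcost prefix_body + 21) +
     (wcost mark_body + 21 +
      (10 + (wcost output_body + 21) + wcost next_block)))))%N.

(** With [n] and [up_log 2 n] both positive, each of the linear, logarithmic and
    constant terms is absorbed by their product. *)
Lemma pair_cost_le n : (1 < n)%N ->
  (pair_cost n <= pair_factor * (n * up_log 2 n))%N.
Proof.
move=> n1; rewrite /pair_cost /sort_cost /pair_factor.
have h0 : (0 < up_log 2 n)%N by rewrite up_log_gt0.
set h := up_log 2 n in h0 *; set x := (n * h)%N.
have nx : (n <= x)%N by rewrite leq_pmulr.
have hx : (h <= x)%N by rewrite leq_pmull //; lia.
have x0 : (0 < x)%N by lia.
have n0 : (0 < n)%N by lia.
have c1 := for_cost_le (wcost classify_body) x0 nx.
have c2 := for_cost_le (wcost prefix_body) x0 nx.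
have c3 := for_cost_le (wcost mark_body) x0 nx.
have c4 := for_cost_le (wcost output_body) x0 nx.
have c5 : (h * (6 + (12 + for_cost n (wcost merge_body) +
                    (for_cost n (wcost copy_back_body) + 7))) <=
    (18 + (wcost merge_body + 21) + (wcost copy_back_body + 21) + 7) * x)%N.
  have d1 := for_cost_le (wcost merge_body) n0 (leqnn n).
  have d2 := for_cost_le (wcost copy_back_body) n0 (leqnn n).
  rewrite /x mulnA mulnC; apply: leq_mul => //; nia.
move: (wcost _) (wcost _) (wcost _) (wcost _) (wcost _) (wcost _) (wcost _) c1 c2 c3 c4 c5.
by move=> w0 *; have := leq_pmulr w0 x0; lia.
Qed.

Definition total_factor : nat :=
  (3 + (wcost count_body + 21) + (3 + (pair_factor + 21)))%N.

Lemma total_cost_le I n K : (0 < I)%N -> (1 < n)%N -> (0 < K)%N ->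
  (total_cost I n K <= total_factor * (I * K * n * up_log 2 n))%N.
Proof.
move=> I0 n1 K0; rewrite /total_cost /total_factor.
have h0 : (0 < up_log 2 n)%N by rewrite up_log_gt0.
have pc := pair_cost_le n1.
rewrite -mulnA; set x := (n * up_log 2 n)%N in pc *.
have x0 : (0 < x)%N by rewrite muln_gt0 h0; lia.
have IK0 : (0 < I * K)%N by rewrite muln_gt0 I0.
have y0 : (0 < I * K * x)%N by rewrite muln_gt0 IK0.
have Iy : (I <= I * K * x)%N by rewrite -mulnA leq_pmulr // muln_gt0 K0.
have c1 := for_cost_le (wcost count_body) y0 Iy.
have c2 : (for_cost (I * K) (pair_cost n) <= (pair_factor + 21) * (I * K * x))%N.
  apply: leq_trans (for_cost_le _ IK0 (leqnn _)) _.
  rewrite (mulnC (I * K)%N x) [leqRHS]mulnA leq_mul2r; apply/orP; right.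
  rewrite mulnDl leq_add //; exact: leq_pmulr.
move: (I * K * x)%N (wcost _) pair_factor (for_cost _ _) (for_cost _ _) y0 c1 c2.
by move=> *; lia.
Qed.

(** The binary logarithm is rounded up, so [2 ^ (up_log 2 n).-1 < n]; the missing
    factor 2 is at most [n]. *)
Lemma up_log_ln n : (1 < n)%N ->
  (up_log 2 n)%:R * ln 2 <= 2 * ln n%:R :> R.
Proof.
move=> n1; have h0 : (0 < up_log 2 n)%N by rewrite up_log_gt0.
have lb : 2%:R ^+ (up_log 2 n).-1 <= n%:R :> R.
  by rewrite -natrX ler_nat ltnW // up_log_gtn.
have l2 : ln 2 <= ln n%:R :> R by rewrite ler_ln ?posrE ?ltr0n ?ler_nat //; lia.
have lh : (up_log 2 n).-1%:R * ln 2 <= ln n%:R :> R.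
  rewrite mulr_natl -lnXn ?ltr0n // ler_ln ?posrE ?exprn_gt0 ?ltr0n //; lia.
by rewrite -(prednK h0) -natr1 mulrDl mul1r mulrDl mul1r lerD.
Qed.

End Transfer.

Theorem proposition3 (R : realType) :
  exists (P : cmd) (C : R),
    forall (I J K : finType) (q r : I -> K -> J -> R) (u : J -> R)
      (s0 : state R),
      (0 < #|I|)%N -> (1 < #|J|)%N -> (0 < #|K|)%N ->
      (forall i k j, 0 <= r i k j) ->
      input_loaded q r u s0 ->
      exists (t : nat) (s1 : state R),
        [/\ exec P s0 t s1,
            forall (i : I) (k : K), algorithm2_recorded q r u s1 i k
          & t%:R <= C * (#|I|%:R * #|K|%:R * #|J|%:R * ln #|J|%:R)].
Proof.
exists algorithm2, (total_factor%:R * (2 / ln 2)) => I J K q r u s0 I0 J1 K0 r_ge0.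
move=> [sI sJ sK sq sr su].
have := runs_algorithm2 s0; rewrite sI sJ sK => -[t [s1 [ex le out]]].
exists t, s1; split=> //.
- move=> i k.
  have /card_gt0P[j0 _] : (0 < #|J|)%N by lia.
  have pIK : (addr2 i k < #|I| * #|K|)%N.
    have := rank_lt i; have := rank_lt k; rewrite /addr2.
    move: (rank i) (rank k) => a b bK aI.
    apply: (@leq_trans (a.+1 * #|K|)%N); first by rewrite mulSnr ltn_add2l.
    by rewrite leq_mul2r aI orbT.
  have [c [w [L [cE wE S]]]] := out _ pIK.
  apply: (solved_run j0 (r_ge0 i k) _ _ S) => j.
    by rewrite cE -/(addr3 i k j) sq su.
  by rewrite wE -/(addr3 i k j) sr.
- have le' := leq_trans le (total_cost_le I0 J1 K0).
  apply: (@le_trans _ _ (total_factor * (#|I| * #|K| * #|J| * up_log 2 #|J|))%:R).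
    by rewrite ler_nat.
  rewrite !natrM -[leRHS]mulrA; apply: ler_wpM2l; first exact: ler0n.
  rewrite mulrCA; apply: ler_wpM2l; first by rewrite !mulr_ge0 ?ler0n.
  by rewrite mulrAC ler_pdivlMr ?ln_gt0 ?ltr1n // up_log_ln.
Qed.
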